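(* For $n \in \mathbb{N}$ let $\mathcal{A}(n) := \#\{ k \in \mathbb{N} : 1 \leq k \leq n,\ R_k^\sigma(X) \text{ is not a Hurwitz polynomial}\}$, where $R_k^\sigma(X)$ is the reduced D'Arcais polynomial. Then $$\liminf_{n \to \infty} \frac{\mathcal{A}(n)}{n} > 0.$$
   Context: Let $\sigma(n) = \sum_{d \mid n} d$. The D'Arcais polynomials $P_n^\sigma(X)$, $n \ge 0$, are defined by the identity of formal power series in $q$ $$\sum_{n=0}^\infty P_n^\sigma(X) q^n = \prod_{m=1}^\infty (1 - q^m)^{-X} = \exp\Big( X \sum_{j=1}^\infty \sigma(j) \frac{q^j}{j} \Big).$$ For $n \geq 1$, $P_n^\sigma(X)$ is a polynomial of degree $n$ with zero constant term, and the reduced D'Arcais polynomial is $R_n^\sigma(X) := P_n^\sigma(X)/X$; it has degree $n-1$ and strictly positive coefficients. A polynomial with positive real coefficients is called a Hurwitz polynomial if all its complex zeros lie in the open left half-plane $\{z \in \mathbb{C} : \Re(z) < 0\}$ (a nonzero constant is vacuously Hurwitz). *)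

(* Defs.v *)
From mathcomp Require Import all_boot all_order all_algebra.
From mathcomp Require Import complex.
From mathcomp Require Import all_classical all_reals all_analysis.

Set Implicit Arguments.
Unset Strict Implicit.
Unset Printing Implicit Defensive.

Import Order.TTheory GRing.Theory Num.Theory.
Local Open Scope ring_scope.

(* A formal power series in q over A is its coefficient sequence. *)
Definition fps (A : Type) : Type := nat -> A.

Definition fps_mul (A : comNzRingType) (f g : fps A) : fps A :=
  fun n => \sum_(i < n.+1) f i * g (n - i)%N.

Definition fps_one (A : comNzRingType) : fps A := fun n => (n == 0%N)%:R.

Definition fps_pow (A : comNzRingType) (f : fps A) (k : nat) : fps A :=
  iter k (fps_mul f) (fps_one A).

(* exp(f) = \sum_k f^k / k!, for f with zero constant term: then f^k does not
   contribute to the coefficient of q^n for k > n, so the sum stops at k = n. *)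
Definition fps_exp (A : comAlgType rat) (f : fps A) : fps A :=
  fun n => \sum_(k < n.+1) (k`!%:R : rat)^-1 *: fps_pow f k n.

Definition sigma (n : nat) : nat := (\sum_(d <- divisors n) d)%N.

(* X * \sum_(j >= 1) sigma(j) q^j / j; the coefficient of q^0 is 0 because
   0^-1 = 0 in rat. *)
Definition darcais_log : fps {poly rat} :=
  fun j => ((sigma j)%:R / j%:R : rat) *: 'X.

Definition darcais (n : nat) : {poly rat} := fps_exp darcais_log n.

(* For n >= 1 this division is exact, see [reduced_darcaisK]. *)
Definition reduced_darcais (n : nat) : {poly rat} := darcais n %/ 'X.

Lemma darcais_log0 : darcais_log 0 = 0.
Proof. by rewrite /darcais_log invr0 mulr0 scale0r. Qed.

Lemma dvdp_darcais n : (0 < n)%N -> 'X %| darcais n.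
Proof.
move=> n_gt0; rewrite /darcais /fps_exp.
apply: (big_ind (fun p : {poly rat} => 'X %| p)) => [|p r|k _];
  [exact: dvdp0 | exact: dvdp_add |].
rewrite -mul_polyC; apply: dvdp_mull; case: (nat_of_ord k) => [|m].
  by rewrite /fps_pow /= /fps_one eqn0Ngt n_gt0 dvdp0.
rewrite /fps_pow /= /fps_mul.
apply: (big_ind (fun p : {poly rat} => 'X %| p)) => [|p r|i _];
  [exact: dvdp0 | exact: dvdp_add |].
by apply: dvdp_mulr; rewrite /darcais_log -mul_polyC dvdp_mull.
Qed.

Lemma reduced_darcaisK n : (0 < n)%N -> reduced_darcais n * 'X = darcais n.
Proof. by move=> n_gt0; rewrite /reduced_darcais divpK // dvdp_darcais. Qed.

(* Positivity of the coefficients is left out, so that [~ hurwitz p] speaks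
   about the location of the zeros only; [reduced_darcais k] with k >= 1 has
   positive coefficients anyway. *)
Definition hurwitz (R : realType) (p : {poly R}) : Prop :=
  forall z : R[i], root (map_poly (real_complex R) p) z -> complex.Re z < 0.

Definition not_hurwitz_count (R : realType) (n : nat) : nat :=
  (\sum_(1 <= k < n.+1 |
      `[< ~ hurwitz (map_poly (@ratr R) (reduced_darcais k)) >]) 1)%N.

(* Main.v *)
Require Import Defs.
From mathcomp Require Import all_boot all_order all_algebra.
From mathcomp Require Import complex ring lra zify.
From mathcomp Require Import all_classical all_reals all_analysis.

(** The coefficient a_(k-1) of R_n is 1/k! times the k-fold convolution of
    s(j) = sigma(j)/j at n. A stable polynomial satisfies a_0 a_3 <= a_1 a_2.
    Here a_0 = s(n), while a_1 = O(n) and a_2 = O(n^2) because s is bounded in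
    quadratic mean, and a_3 is at least of order n^3 because s >= 1. Hence
    R_n Hurwitz forces s(n) to be bounded by an absolute constant. But s(n) is
    at least the harmonic number H_m when m! divides n, so all large multiples
    of a fixed m! give non-Hurwitz polynomials. *)

Set Implicit Arguments.
Unset Strict Implicit.
Unset Printing Implicit Defensive.

Import Order.TTheory GRing.Theory Num.Theory.
Local Open Scope ring_scope.

(** * Coefficient inequalities for Hurwitz polynomials *)

Lemma hurwitz_dvdr (R : realType) (p q : {poly R}) :
  hurwitz (q * p) -> hurwitz q.
Proof. by move=> h z rz; apply: h; rewrite rmorphM rootM rz. Qed.

(** The remainder modulo the quadratic is a real polynomial m0 + m1 X that vanishes at x + iy. The
    imaginary part m1 y of its value forces m1 = 0, as y is nonzero, and then m0 = 0. *)
Lemma real_quadratic_dvdp (R : rcfType) (p : {poly R}) (x y : R) :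
  y != 0 -> root (map_poly (real_complex R) p) (x +i* y)%C ->
  'X^2 - (2 * x) *: 'X + (x ^+ 2 + y ^+ 2)%:P %| p.
Proof.
move=> y0 rz; set r := (X in X %| p).
have size_r : size r = 3%N.
  rewrite /r -addrA size_polyDl size_polyXn //.
  apply: (leq_ltn_trans (size_polyD _ _)).
  rewrite gtn_max (leq_ltn_trans (size_polyC_leq1 _)) // andbT.
  rewrite -scaleNr; apply: (leq_ltn_trans (size_scale_leq _ _)).
  by rewrite size_polyX.
have r_neq0 : r != 0 by rewrite -size_poly_eq0 size_r.
have : (size (p %% r)%R < 3)%N by rewrite -size_r ltn_modp.
rewrite /dvdp; set m := (p %% r)%R; rewrite ltnS => size_m.
have mE : m = (m`_0)%:P + m`_1 *: 'X.
  apply/polyP => -[|[|i]]; rewrite coefD coefC coefZ coefX /=; try lra.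
  rewrite mulr0 addr0 nth_default //; exact: leq_trans size_m _.
move: rz; rewrite (divp_eq p r) -/m rmorphD rmorphM /= /root hornerD hornerM.
have -> : (map_poly (real_complex R) r).[(x +i* y)%C] = 0.
  rewrite /r rmorphD rmorphB /= map_polyZ map_polyXn map_polyX map_polyC /=.
  rewrite !hornerE; simpc; apply/eqP; rewrite eq_complex /= expr2; simpc => /=.
  by apply/andP; split; apply/eqP; ring.
rewrite mulr0 add0r mE rmorphD /= map_polyC map_polyZ map_polyX !hornerE.
rewrite eq_complex /=; simpc => /andP[/eqP m0 /eqP m1].
have m10 : m`_1 = 0.
  have /eqP : m`_1 * y = 0 by lra.
  by rewrite mulf_eq0 (negbTE y0) orbF => /eqP.
have -> : m`_0 = 0 by move: m0; rewrite m10; lra.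
by rewrite m10 scale0r addr0.
Qed.

(* The inequalities survive multiplication by a real factor X + a or
   X^2 + b X + c with a, b, c > 0. *)
Lemma hurwitz_coef (R : realType) (p : {poly R}) :
  hurwitz p -> 0 < p`_0 ->
  [/\ 0 <= p`_1, 0 <= p`_2, 0 <= p`_3 & p`_0 * p`_3 <= p`_1 * p`_2].
Proof.
have [n] := ubnP (size p); elim: n p => // n IHn p size_p hp p0.
have pn0 : p != 0 by apply: contraTneq p0 => ->; rewrite coef0 ltxx.
have [s1|s1] := eqVneq (size p) 1%N.
  have z i : p`_i.+1 = 0 by rewrite nth_default // s1.
  by rewrite !z !mulr0 lexx.
have : size (map_poly (real_complex R) p) != 1%N by rewrite size_map_poly.
case/closed_rootP => -[x y] rz.
have /= x_lt0 := hp _ rz.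
have [y0|y0] := eqVneq y 0.
  have px : 'X - x%:P %| p.
    rewrite -root_factor_theorem -(fmorph_root (real_complex R)).
    by move: rz; rewrite y0.
  have := divpK px; set q := p %/ _ => qE.
  have qs : (size q < n)%N.
    rewrite -qE size_Mmonic ?monicXsubC // ?size_XsubC in size_p.
      by move: size_p; rewrite addn2 /= ltnS.
    by apply: contraNneq pn0 => q0; rewrite -qE q0 mul0r.
  have hq : hurwitz q by apply: (@hurwitz_dvdr _ ('X - x%:P)); rewrite qE.
  have cE i : p`_i = (if i is j.+1 then q`_j else 0) - x * q`_i.
    rewrite -qE mulrBr coefB coefMC coefMX [q`_i * x]mulrC.
    by case: i.
  have q0 : 0 < q`_0 by move: p0; rewrite cE; nra.
  have [q1 q2 q3 q03] := IHn q qs hq q0.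
  (* With a = -x > 0, p1 p2 - p0 p3 = q0 q1 + a q1^2 + a^2 (q1 q2 - q0 q3). *)
  rewrite !cE; split; nra.
have := real_quadratic_dvdp y0 rz.
set r := (X in X %| p) => rp.
have := divpK rp; set q := p %/ _ => qE.
have cE i : p`_i = (if i is j.+2 then q`_j else 0)
   - 2 * x * (if i is j.+1 then q`_j else 0) + (x ^+ 2 + y ^+ 2) * q`_i.
  rewrite -qE /r mulrDr mulrBr coefD coefB coefMC -scalerAr coefZ coefMX coefMXn.
  rewrite [q`_i * _]mulrC; case: i => [|[|i]] //=.
  by rewrite subSS subSS subn0.
have q_neq0 : q != 0 by apply: contraNneq pn0 => q0; rewrite -qE q0 mul0r.
have r_size : (2 < size r)%N.
  rewrite ltnNge; apply/negP => /leq_sizeP /(_ _ (leqnn 2)).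
  rewrite /r coefD coefB coefZ coefC coefX coefXn /= mulr0 subr0 addr0.
  by apply/eqP; rewrite oner_eq0.
have qs : (size q < n)%N.
  have r_neq0 : r != 0 by rewrite -size_poly_gt0 (ltn_trans _ r_size).
  move: size_p r_size; rewrite -qE size_mul //.
  by move: (size q) (size r) => a b; lia.
have hq : hurwitz q by apply: (@hurwitz_dvdr _ r); rewrite qE.
have yy : 0 < y ^+ 2 by rewrite exprn_even_gt0.
have c_gt0 : 0 < x ^+ 2 + y ^+ 2 by nra.
have q0 : 0 < q`_0 by move: p0; rewrite cE /= mulr0 subrr add0r pmulr_rgt0.
have [q1 q2 q3 q03] := IHn q qs hq q0.
rewrite !cE /=; move: c_gt0; set c := _ + _ => c_gt0.
have b_gt0 : 0 < - (2 * x) by lra.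
move: b_gt0; set b := - _ => b_gt0; rewrite -[2 * x]opprK -/b.
have := mulr_ge0 (ltW c_gt0) q1; have := mulr_ge0 (ltW c_gt0) q2.
have := mulr_ge0 (ltW c_gt0) q3; have := mulr_ge0 (ltW b_gt0) q1.
have := mulr_ge0 (ltW b_gt0) q2; have := mulr_ge0 (ltW b_gt0) (ltW q0).
move=> *; split; try lra.
(* This sum is exactly p1 p2 - p0 p3, expanded in the coefficients of [q]. *)
have : 0 <= c ^+ 2 * (q`_1 * q`_2 - q`_0 * q`_3) + b * c * q`_1 ^+ 2
    + b ^+ 2 * (q`_0 * q`_1) + b * q`_0 ^+ 2.
  by rewrite !addr_ge0 // !mulr_ge0 ?sqr_ge0 ?subr_ge0 // ltW.
by move=> *; lra.
Qed.

(** * Abundancy and harmonic numbers *)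

Definition abundancy (n : nat) : rat := (sigma n)%:R / n%:R.

Definition harmonic_number (n : nat) : rat := \sum_(1 <= d < n.+1) d%:R^-1.

Lemma harmonic_number_ge0 n : 0 <= harmonic_number n.
Proof. by apply: sumr_ge0 => i _; rewrite invr_ge0. Qed.

Lemma harmonic_numberS n :
  harmonic_number n.+1 = harmonic_number n + n.+1%:R^-1.
Proof. by rewrite /harmonic_number big_nat_recr. Qed.

(** The 2^k terms with 2^k < d <= 2^(k+1) are each at least 1/2^(k+1), so every dyadic block adds at
    least 1/2. *)
Lemma harmonic_number_expn2 k : k%:R / 2 <= harmonic_number (2 ^ k).
Proof.
elim: k => [|k IHk]; first by rewrite mul0r harmonic_number_ge0.
rewrite /harmonic_number (big_cat_nat _ (n := (2 ^ k).+1)) //=; last first.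
  by rewrite ltnS leq_exp2l.
rewrite -natr1 mulrDl lerD //.
have -> : 1 / 2 = \sum_((2 ^ k).+1 <= d < (2 ^ k.+1).+1) ((2 ^ k.+1)%:R^-1 : rat).
  rewrite sumr_const_nat subSS expnS mul2n -addnn addnK -mulr_natl natrD.
  have : (2 ^ k)%:R != 0 :> rat by rewrite pnatr_eq0 expn_eq0.
  by move=> ?; field.
apply: ler_sum_nat => d /andP[d1 d2].
by rewrite lef_pV2 ?ler_nat // posrE ltr0n ?expn_gt0 // (leq_trans _ d1).
Qed.

(** The involution d -> j/d on the divisors of j turns sigma(j)/j into a sum of reciprocals. The
    range reaches up to a common n so that sums over j and d can be exchanged. *)
Lemma abundancyE n j : (0 < j <= n)%N ->
  abundancy j = \sum_(1 <= d < n.+1) (d %| j)%:R / d%:R.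
Proof.
move=> /andP[j0 jn].
rewrite (big_cat_nat _ (n := j.+1)) //= [X in _ + X]big_nat_cond.
rewrite [X in _ + X]big1 ?addr0; last first.
  move=> d /andP[/andP[jd _] _]; by rewrite gtnNdvd ?mul0r.
rewrite /abundancy /sigma natr_sum mulr_suml.
have -> : \sum_(1 <= d < j.+1) ((d %| j)%:R / d%:R : rat) =
    \sum_(d <- divisors j) d%:R^-1.
  rewrite (eq_bigr (fun d => if (d %| j)%N then d%:R^-1 else 0)); last first.
    by move=> d _; case: ifP => _; rewrite ?mul0r ?mul1r.
  rewrite -big_mkcond -big_filter; apply: perm_big; apply: uniq_perm.
  - by rewrite filter_uniq ?iota_uniq.
  - exact: divisors_uniq.
  move=> d; rewrite mem_filter mem_index_iota -dvdn_divisors // ltnS.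
  case: (boolP (d %| j)%N) => //= dj.
  by rewrite (dvdn_gt0 j0 dj) dvdn_leq.
have divK a : (a %| j)%N -> (j %/ (j %/ a))%N = a.
  by move=> aj; rewrite divnA // mulKn.
rewrite [RHS](perm_big [seq (j %/ d)%N | d <- divisors j]); last first.
  apply: uniq_perm; rewrite ?divisors_uniq //.
    rewrite map_inj_in_uniq ?divisors_uniq // => a b.
    rewrite -!dvdn_divisors // => aj bj e.
    by rewrite -(divK a aj) e divK.
  move=> d; apply/idP/mapP => [|[e]]; rewrite -!dvdn_divisors //.
    move=> dj; exists (j %/ d)%N; rewrite -?dvdn_divisors ?dvdn_div //.
    by rewrite divK.
  by move=> ej ->; rewrite dvdn_div.
rewrite big_map !big_seq; apply: eq_bigr => d.
rewrite -dvdn_divisors // => dj.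
rewrite -[in LHS](divnK dj) natrM invfM mulrCA divff ?mulr1 //.
by rewrite pnatr_eq0 -lt0n (dvdn_gt0 j0 dj).
Qed.

Lemma abundancy_ge1 n : (0 < n)%N -> 1 <= abundancy n.
Proof.
move=> n0; rewrite (@abundancyE n) ?n0 ?leqnn // big_ltn ?ltnS // dvd1n divr1.
by rewrite lerDl sumr_ge0 // => d _; rewrite divr_ge0.
Qed.

(** All d <= m divide m!, hence n, so their reciprocals all occur in the divisor sum. *)
Lemma abundancy_fact_ge m n : (0 < n)%N -> (m`! %| n)%N ->
  harmonic_number m <= abundancy n.
Proof.
move=> n0 mn.
have mlen : (m <= n)%N.
  by apply: leq_trans (dvdn_leq n0 mn); case: m {mn} => // m; rewrite factS leq_pmulr ?fact_gt0.
rewrite (@abundancyE n) ?n0 ?leqnn // (big_cat_nat _ (n := m.+1)) //=.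
rewrite -[leLHS]addr0 lerD //; last by rewrite sumr_ge0 // => d _; rewrite divr_ge0.
apply: ler_sum_nat => d /andP[d1 dm].
by rewrite (dvdn_trans _ mn) ?mul1r // dvdn_fact ?d1.
Qed.

(** * Quadratic mean of the abundancy *)

(* Each pair of indices is charged to its larger element. *)
Lemma sqr_sum_le (x : nat -> rat) n : (forall i, 0 <= x i) ->
  (\sum_(1 <= i < n.+1) x i) ^+ 2 <=
    2 * \sum_(1 <= i < n.+1) x i * \sum_(1 <= k < i.+1) x k.
Proof.
move=> x0; elim: n => [|n IHn]; first by rewrite !big_nil mulr0 expr0n.
have recr F : \sum_(1 <= i < n.+2) F i = \sum_(1 <= i < n.+1) F i + F n.+1 :> rat.
  exact: big_nat_recr.
rewrite !recr.
move: IHn; set A := \sum_(1 <= i < n.+1) x i; set B := \sum_(_ <= _ < _) _ => IH.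
by have := x0 n.+1; nra.
Qed.

Lemma sum_harmonic_number_div_sqr n :
  \sum_(1 <= d < n.+1) harmonic_number d / d%:R ^+ 2 <= 3.
Proof.
case: n => [|n]; first by rewrite big_nil.
(* The tail of the series from n + 1 on is at most (H_n + 1) / n. *)
suff: \sum_(1 <= d < n.+2) harmonic_number d / d%:R ^+ 2
    + (harmonic_number n.+1 + 1) / n.+1%:R <= 3.
  by apply: le_trans; rewrite lerDl divr_ge0 // addr_ge0 // harmonic_number_ge0.
elim: n => [|n IHn].
  (* The first term is 1 and the bound on the tail is 2, whence the constant 3. *)
  by rewrite /harmonic_number !big_nat1; lra.
rewrite big_nat_recr //=; apply: le_trans IHn; rewrite -addrA lerD2l.
rewrite harmonic_numberS; have := harmonic_number_ge0 n.+1.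
set h := harmonic_number _ => h0.
have: 0 < n.+1%:R :> rat by rewrite ltr0n.
rewrite -[n.+2%:R]natr1; move: n.+1%:R => x x0.
rewrite -subr_ge0.
have -> : (h + 1) / x - ((h + (x + 1)^-1) / (x + 1) ^+ 2
    + (h + (x + 1)^-1 + 1) / (x + 1)) =
  (h + (x + 1)^-1) / (x * (x + 1) ^+ 2) by field; rewrite !gt_eqF //; lra.
by rewrite divr_ge0 ?addr_ge0 ?invr_ge0 ?mulr_ge0 ?sqr_ge0 //; lra.
Qed.

(** In the square of the divisor sum, a pair of divisors is charged to the larger one, d, and
    divisibility by the smaller is dropped, which leaves a factor H_d. After exchanging the sums, d
    has at most n/d multiples up to n, so the total is at most 2 n times the sum of H_d/d^2. *)
Lemma sum_abundancy_sqr n : \sum_(1 <= j < n.+1) abundancy j ^+ 2 <= 6 * n%:R.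
Proof.
pose x j d : rat := (d %| j)%:R / d%:R.
have x0 j d : 0 <= x j d by rewrite divr_ge0.
have step1 j : (0 < j < n.+1)%N ->
    abundancy j ^+ 2 <= 2 * \sum_(1 <= d < n.+1) x j d * harmonic_number d.
  move=> jn; rewrite (@abundancyE n) //.
  apply: le_trans (sqr_sum_le _ (x0 j)) _; rewrite ler_pM2l //.
  apply: ler_sum => d _; apply: ler_wpM2l => //; apply: ler_sum => e _.
  by rewrite ler_piMl ?invr_ge0 // lern1 leq_b1.
apply: le_trans (ler_sum_nat step1) _.
rewrite -mulr_sumr exchange_big /=.
have -> : 6 * n%:R = 2 * (n%:R * 3) :> rat by ring.
rewrite ler_pM2l //.
apply: (@le_trans _ _ (n%:R * \sum_(1 <= d < n.+1) harmonic_number d / d%:R ^+ 2)); last first.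
  by rewrite ler_wpM2l // sum_harmonic_number_div_sqr.
rewrite mulr_sumr; apply: ler_sum_nat => d /andP[d0 _].
rewrite -mulr_suml -mulr_suml -natr_sum -divn_count_dvd.
rewrite [harmonic_number d / _]mulrC mulrA ler_wpM2r ?harmonic_number_ge0 //.
have dpos : 0 < d%:R :> rat by rewrite ltr0n.
rewrite expr2 invfM mulrA ler_wpM2r ?invr_ge0 ?ler0n // ler_pdivlMr //.
by rewrite -natrM ler_nat leq_trunc_div.
Qed.

(** * Coefficients as convolution powers of the abundancy *)

Lemma fps_powS (A : comNzRingType) (f : fps A) k n :
  fps_pow f k.+1 n = \sum_(i < n.+1) f i * fps_pow f k (n - i)%N.
Proof. by []. Qed.

Lemma fps_pow1 (A : comNzRingType) (f : fps A) n : fps_pow f 1 n = f n.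
Proof.
rewrite fps_powS big_ord_recr big1 /= ?add0r ?subnn ?mulr1 // => i _.
by rewrite /fps_one subn_eq0 leqNgt ltn_ord mulr0.
Qed.

(** Every factor carries one X, so only the k-th term of the exponential contributes to X^k. *)
Lemma fps_powZX (A : comNzRingType) (f : fps A) k n :
  fps_pow (fun j => f j *: 'X) k n = fps_pow f k n *: 'X^k.
Proof.
elim: k n => [|k IHk] n; first by rewrite /fps_pow /= /fps_one scaler_nat.
rewrite !fps_powS scaler_suml; apply: eq_bigr => i _.
by rewrite IHk -scalerAl -scalerAr scalerA -exprS.
Qed.

Lemma darcais_coef n k : (k <= n)%N ->
  (darcais n)`_k = fps_pow abundancy k n / k`!%:R.
Proof.
move=> kn.
have powE i : fps_pow darcais_log i n = fps_pow abundancy i n *: 'X^i.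
  exact: fps_powZX.
rewrite /darcais /fps_exp coef_sum (bigD1 (Ordinal (kn : k < n.+1)%N)) //=.
rewrite big1 => [|i ik]; rewrite coefZ powE coefZ coefXn.
  by rewrite eqxx mulr1 addr0 mulrC.
case: eqP => [e|_]; last by rewrite !mulr0.
by case/eqP: ik; apply/val_inj.
Qed.

Lemma reduced_darcais_coef n k : (k < n)%N ->
  (reduced_darcais n)`_k = fps_pow abundancy k.+1 n / (k.+1)`!%:R.
Proof.
move=> kn; rewrite -darcais_coef // -(reduced_darcaisK (leq_ltn_trans _ kn)) //.
by rewrite coefMX.
Qed.

(** * Bounds on the convolution powers *)

Lemma abundancy0 : abundancy 0 = 0.
Proof. by rewrite /abundancy invr0 mulr0. Qed.

Lemma abundancy_ge0 n : 0 <= abundancy n.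
Proof. by rewrite /abundancy divr_ge0. Qed.

Lemma fps_pow_abundancy_ge0 k n : 0 <= fps_pow abundancy k n.
Proof.
elim: k n => [|k IHk] n; first by rewrite /fps_pow /= /fps_one.
by rewrite fps_powS sumr_ge0 // => i _; rewrite mulr_ge0 ?abundancy_ge0.
Qed.

Lemma sum_bin n k : (\sum_(i < n) 'C(i, k) = 'C(n, k.+1))%N.
Proof.
by elim: n => [|n IHn]; rewrite ?big_ord0 // big_ord_recr /= IHn binS.
Qed.

(** The binomial counts the compositions of m + 1 into k + 1 positive parts, and each contributes a
    product of abundancies, all at least 1. *)
Lemma fps_pow_abundancy_ge k m : 'C(m, k)%:R <= fps_pow abundancy k.+1 m.+1.
Proof.
elim: k m => [|k IHk] m; first by rewrite fps_pow1 bin0 abundancy_ge1.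
(* The term of index 0 vanishes; the one of index m + 1 is nonnegative and is dropped. *)
rewrite fps_powS big_ord_recl abundancy0 mul0r add0r big_ord_recr.
rewrite -[leLHS]addr0 lerD ?mulr_ge0 ?abundancy_ge0 ?fps_pow_abundancy_ge0 //.
rewrite -sum_bin natr_sum (reindex_inj rev_ord_inj) /=; apply: ler_sum => i _.
rewrite /bump leq0n add1n subSS -[(m - i)%N]subnSK //; apply: le_trans (IHk _) _.
by apply: ler_peMl; [exact: fps_pow_abundancy_ge0 | exact: abundancy_ge1].
Qed.

(** Each product s(i) s(n-i) is at most (s(i)^2 + s(n-i)^2)/2, and i -> n - i identifies the two
    sums of squares. *)
Lemma fps_pow2_abundancy_le n : fps_pow abundancy 2 n <= 6 * n%:R.
Proof.
apply: le_trans (sum_abundancy_sqr n).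
have sE : \sum_(1 <= j < n.+1) abundancy j ^+ 2 = \sum_(i < n.+1) abundancy i ^+ 2.
  by rewrite -(big_mkord predT (fun j => abundancy j ^+ 2)) [RHS]big_ltn // abundancy0 expr0n add0r.
rewrite sE fps_powS.
have sR : \sum_(i < n.+1) abundancy i ^+ 2 = \sum_(i < n.+1) abundancy (n - i) ^+ 2.
  by rewrite (reindex_inj rev_ord_inj); apply: eq_bigr => i _ /=; rewrite subSS.
have -> : \sum_(i < n.+1) abundancy i ^+ 2 =
    \sum_(i < n.+1) (abundancy i ^+ 2 + abundancy (n - i) ^+ 2) / 2.
  by rewrite -mulr_suml big_split /= -sR; field.
by apply: ler_sum => i _; rewrite fps_pow1;
  have := sqr_ge0 (abundancy i - abundancy (n - i)); lra.
Qed.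

Lemma sum_abundancy_le n : \sum_(i < n.+1) abundancy i <= 6 * n%:R.
Proof.
apply: le_trans (sum_abundancy_sqr n).
rewrite -(big_mkord predT abundancy) [leLHS]big_ltn // abundancy0 add0r.
by apply: ler_sum_nat => j /andP[/abundancy_ge1 j1 _]; nra.
Qed.

Lemma fps_pow3_abundancy_le n : fps_pow abundancy 3 n <= 36 * n%:R ^+ 2.
Proof.
rewrite fps_powS; apply: (@le_trans _ _ (\sum_(i < n.+1) abundancy i * (6 * n%:R))).
  apply: ler_sum => i _; rewrite ler_wpM2l ?abundancy_ge0 //.
  apply: le_trans (fps_pow2_abundancy_le _) _.
  by rewrite ler_pM2l // ler_nat leq_subr.
rewrite -mulr_suml; have := sum_abundancy_le n; have : 0 <= n%:R :> rat by [].
by nra.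
Qed.

(** Written in powers of n + 1, the index of the polynomial, so that the cubes cancel in the final
    comparison. *)
Lemma bin3_ge n : (5 <= n)%N -> n.+1%:R ^+ 3 / 48 <= 'C(n, 3)%:R :> rat.
Proof.
move=> n5; rewrite ler_pdivrMr // -natrX -natrM ler_nat.
have e : (n ^_ 3 = n * n.-1 * n.-2)%N by rewrite !ffactnSr ffactn0 mul1n subn0 subn1 subn2.
have := bin_ffact n 3; rewrite e (_ : 3`! = 6)%N //.
by case: n n5 {e} => [|[|[|n]]] //= n5; nia.
Qed.

(* 144 ^ 2 = 2 * 6 * 36 * 48 *)
Lemma abundancy_le_of_hurwitz (R : realType) n :
  (5 <= n)%N -> hurwitz (map_poly (@ratr R) (reduced_darcais n.+1)) ->
  abundancy n.+1 <= 144 ^+ 2.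
Proof.
move=> n5 /hurwitz_coef; rewrite !coef_map.
have := fps_pow_abundancy_ge 3 n; have := bin3_ge n5.
have n0 : 0 < n.+1%:R ^+ 3 :> rat by rewrite exprn_gt0 // ltr0n.
have a1 := abundancy_ge1 (ltn0Sn n); move: a1 n0.
have coefE k (k6 : (k < 6)%N) := reduced_darcais_coef (leq_trans k6 (n5 : 5 < n.+1)%N).
rewrite (coefE 0%N isT) (coefE 1%N isT) (coefE 2%N isT) (coefE 3%N isT).
rewrite [fps_pow _ 1 _]fps_pow1 divr1.
have {coefE} -> : 4`! = 24%N by [].
have -> : 3`! = 6%N by [].
have -> : 2`! = 2%N by [].
have := fps_pow2_abundancy_le n.+1; have := fps_pow3_abundancy_le n.+1.
have := fps_pow_abundancy_ge0 3 n.+1; have := fps_pow_abundancy_ge0 2 n.+1.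
move: (abundancy n.+1) (fps_pow _ 2 n.+1) (fps_pow _ 3 n.+1) (fps_pow _ 4 n.+1).
move: n.+1%:R 'C(n, 3)%:R => m c a t2 t3 t4 t2_ge0 t3_ge0 t3_le t2_le a1 m0 cm ct.
have a0 : 0 < a by apply: lt_le_trans a1.
(* With the factorials 1!, 2!, 3!, 4!, the coefficient inequality amounts to a t4 <= 2 t2 t3. *)
rewrite ltr0q => /(_ a0) [_ _ _]; rewrite -!rmorphM ler_rat => le.
have le1 : a * (m ^+ 3 / 48) <= a * t4.
  by rewrite ler_wpM2l ?(le_trans cm ct) // ltW.
have le2 := ler_pM t2_ge0 t3_ge0 t2_le t3_le.
by rewrite -(ler_pM2r m0); lra.
Qed.

(** * Lower density of the non-Hurwitz indices *)

Lemma harmonic_number_unbounded (x : rat) : exists m, x < harmonic_number m.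
Proof.
pose k := Num.bound `|2 * x|.
exists (2 ^ k)%N; apply: lt_le_trans (harmonic_number_expn2 k).
have := archi_boundP (normr_ge0 (2 * x)); have := ler_norm (2 * x).
by rewrite -/k => *; rewrite ltr_pdivlMr //; lra.
Qed.

(** Of the multiples of M up to n, at most n0 lie below n0; all others are counted. *)
Lemma not_hurwitz_count_ge (R : realType) (M n0 n : nat) :
  (forall k, (n0 <= k)%N -> (M %| k)%N ->
     ~ hurwitz (map_poly (@ratr R) (reduced_darcais k))) ->
  (n %/ M <= not_hurwitz_count R n + n0)%N.
Proof.
move=> hM; rewrite divn_count_dvd /not_hurwitz_count.
have -> : (\sum_(1 <= i < n.+1) (M %| i) = \sum_(1 <= i < n.+1 | M %| i) 1)%N.
  by rewrite [RHS]big_mkcond; apply: eq_bigr => i _; case: (M %| i)%N.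
rewrite [X in (_ <= X + _)%N]big_mkcond [X in (X <= _)%N]big_mkcond.
apply: (@leq_trans (\sum_(1 <= k < n.+1)
    ((if `[< ~ hurwitz (map_poly (@ratr R) (reduced_darcais k)) >] then 1 else 0)
      + (k < n0)))%N).
  apply: leq_sum => k _; case: (boolP (M %| k)%N) => // Mk.
  case: (ltnP k n0) => kn; first by rewrite addn1.
  by have /asboolP -> := hM _ kn Mk.
rewrite big_split leq_add2l.
have {hM}: (\sum_(1 <= k < n.+1) (k < n0)%N <= minn n n0)%N.
  elim: n => [|n IHn]; first by rewrite big_nil.
  by rewrite big_nat_recr //=; case: ltnP; lia.
by move/leq_trans; apply; exact: geq_minr.
Qed.

Theorem theorem1p2 (R : realType) :
  (0 < limn_einf (fun n : nat => ((not_hurwitz_count R n)%:R / n%:R : R)%:E))%E.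
Proof.
have [M M0 not_hw] : exists2 M, (0 < M)%N & forall k, (6 <= k)%N -> (M %| k)%N ->
    ~ hurwitz (map_poly (@ratr R) (reduced_darcais k)).
  have [m hm] := harmonic_number_unbounded (144 ^+ 2).
  exists m`!; first exact: fact_gt0.
  move=> [//|k] k5 mk /(abundancy_le_of_hurwitz k5); apply/negP.
  by rewrite -ltNge; apply: lt_le_trans hm (abundancy_fact_ge _ mk).
have count n : (n %/ M <= not_hurwitz_count R n + 6)%N.
  exact: not_hurwitz_count_ge not_hw.
(* Half of the density 1/M of the multiples of M, to absorb the additive loss. *)
pose c : R := (2 * M)%:R^-1.
have c0 : 0 < c by rewrite invr_gt0 ltr0n muln_gt0.
apply: (@lt_le_trans _ _ c%:E); first by rewrite lte_fin.
rewrite limn_einf_lim (cvg_lim _ (@cvg_einfs_sup _ _)); last exact: ereal_hausdorff.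
(* A liminf is the supremum of the infima over tails, so one tail suffices. If a is the count, then
   n < (a + 7) M; for n >= 14 M this gives a > 7, hence n < 2 M a. *)
apply: ereal_sup_ge; exists (einfs (fun n => ((not_hurwitz_count R n)%:R / n%:R : R)%:E) (14 * M)%N).
  by exists (14 * M)%N.
apply: le_ereal_inf_tmp => _ [n /= nM <-]; rewrite lee_fin /c.
have n0 : (0 < n)%N by apply: leq_trans nM; rewrite muln_gt0.
rewrite ler_pdivlMr ?ltr0n // mulrC ler_pdivrMr ?ltr0n ?muln_gt0 //.
rewrite -natrM ler_nat.
have := count n; have := divn_eq n M; have := ltn_pmod n M0.
move: (n %/ M)%N (n %% M)%N (not_hurwitz_count R n) => q r a.
by nia.
Qed.
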